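(* Let $b$ be a function with domain $\omega$ with $b(i)\neq\emptyset$ for all $i$, and $h\in\omega^\omega$ with $h\geq^*1$ and $h(i)<|b(i)|$ for all but finitely many $i$. If $h$ does not go to infinity, then $\mathfrak{d}^{\mathrm{Lc}}_{b,h}\geq\mathfrak{c}$ and $\mathfrak{b}^{\mathrm{Lc}}_{b,h}=N+1$, where $N$ is the least natural number such that $A_N:=\{i<\omega:h(i)=N\}$ is infinite. Moreover, $\mathfrak{d}^{\mathrm{Lc}}_{b,h}=\mathfrak{c}$ when $|b(i)|\leq\mathfrak{c}$ for all but finitely many $i$.
   Context: $\prod b=\prod_i b(i)$; $\mathcal{S}(b,h)=\prod_i[b(i)]^{\leq h(i)}$; $x\in^*\varphi$ means $x(i)\in\varphi(i)$ for all but finitely many $i$. $\mathfrak{b}^{\mathrm{Lc}}_{b,h}$ is the least size of an $F\subseteq\prod b$ such that no $\varphi\in\mathcal{S}(b,h)$ has $x\in^*\varphi$ for all $x\in F$; $\mathfrak{d}^{\mathrm{Lc}}_{b,h}$ is the least size of a $D\subseteq\mathcal{S}(b,h)$ such that every $x\in\prod b$ has $x\in^*\varphi$ for some $\varphi\in D$. $\mathfrak{c}=2^{\aleph_0}$. *)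

(* Defs.v *)
From mathcomp Require Import all_boot.
From mathcomp Require Import mathcomp_extra boolp classical_sets functions.
From mathcomp Require Import cardinality filter.

Set Implicit Arguments.
Unset Strict Implicit.
Unset Printing Implicit Defensive.

Local Open Scope classical_set_scope.
Local Open Scope card_scope.

Definition card_lt (T U : Type) (A : set T) (B : set U) : Prop :=
  A #<= B /\ ~ (B #<= A).

(** Cardinals are represented by sets up to [#=]. In particular
    [min_size P] stands for the least cardinality of a member of [P]: it is a
    chosen member of [P] of least cardinality, which exists as soon as [P] is
    nonempty ([min_sizeP]); it is [set0] for empty [P]. *)
Definition has_min_size (T : Type) (P : set (set T)) : set (set T) :=
  [set A | P A /\ forall B, P B -> A #<= B].

Definition min_size (T : Type) (P : set (set T)) : set T :=
  xget set0 (has_min_size P).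

Lemma has_min_size_ex (T : Type) (P : set (set T)) :
  P !=set0 -> has_min_size P !=set0.
Proof.
move=> [F0 PF0].
have [PP|nPP] := pselect (P set0).
  by exists set0; split => // B _; exact: card_ge0.
have pick F : P F -> exists x, F x.
  move=> PF; apply: contrapT => nF; apply: nPP.
  suff -> : set0 = F by [].
  by apply/seteqP; split => x // Fx; case: nF; exists x.
have [t0 _] := pick _ PF0.
pose good (S : set (set T -> T)) :=
  (forall g F, S g -> P F -> F (g F)) /\
  (forall g g' F, S g -> S g' -> P F -> g F = g' F -> g = g').
have [S [[S1 S2] Smax]] : exists A, good A /\ forall B, A `<` B -> ~ good B.
  apply: Zorn_bigcup => C Cgood Ctot; split.
    by move=> g F [X CX Xg]; have [h _] := Cgood _ CX; exact: h.
  move=> g g' F [X CX Xg] [Y CY Yg'].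
  have [XY|YX] := Ctot _ _ CX CY.
  - by have [_] := Cgood _ CY; apply => //; exact: XY.
  - by have [_] := Cgood _ CX; apply => //; exact: YX.
have [F [PF FS]] : exists F, P F /\ forall x, F x -> exists2 g, S g & g F = x.
  apply: contrapT => H.
  have out F : exists x, P F -> F x /\ forall g, S g -> g F <> x.
    have [PF|nPF] := pselect (P F); last by exists t0.
    apply: contrapT => H1; apply: H; exists F; split => // x Fx.
    apply: contrapT => H2; apply: H1; exists x => _; split => // g Sg gx.
    by apply: H2; exists g.
  have [g gP] := choice out.
  apply: (Smax (S `|` [set g])).
    split; first by move=> x; left.
    move=> /(_ g (or_intror erefl)) Sg.
    by have [_ /(_ _ Sg)] := gP _ PF0.
  split.
    by move=> k F [Sk|->] PF; [exact: (S1 _ _ Sk PF)|have [] := gP _ PF].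
  move=> k k' F [Sk|->] [Sk'|->] PF //.
  - exact: S2.
  - by move=> e; have [_ /(_ _ Sk)] := gP _ PF.
  - by move=> e; have [_ /(_ _ Sk')] := gP _ PF; rewrite e.
exists F; split => // B PB.
have /choice[f fP] : forall x, exists g, F x -> S g /\ g F = x.
  move=> x; have [Fx|nFx] := pselect (F x).
    by have [g Sg gx] := FS _ Fx; exists g.
  by exists (fun=> t0).
have finj : {in F &, injective (fun x => f x B)}.
  move=> x y; rewrite !inE => /fP[Sx ex] /fP[Sy ey] /(S2 _ _ _ Sx Sy PB) e.
  by rewrite -ex -ey e.
rewrite -(card_le_eql (inj_card_eq finj)); apply: subset_card_le => _ [x Fx <-].
by have [Sf _] := fP _ Fx; exact: (S1 _ _ Sf PB).
Qed.

Lemma min_sizeP (T : Type) (P : set (set T)) :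
  P !=set0 -> has_min_size P (min_size P).
Proof.
by move=> /has_min_size_ex[A AP]; exact: (xgetPex set0 (ex_intro _ A AP)).
Qed.

Unset Implicit Arguments.

(** A set-valued function [b] on [nat] is a family of types, with product
    [forall i, b i]. *)
Definition slaloms (b : nat -> Type) (h : nat -> nat) :
    set (forall i, set (b i)) :=
  [set phi | forall i, phi i #<= `I_(h i)].

Definition localized {b : nat -> Type} (x : forall i, b i)
    (phi : forall i, set (b i)) : Prop :=
  \forall i \near \oo, phi i (x i).

Definition Lc_unbounded (b : nat -> Type) (h : nat -> nat) :
    set (set (forall i, b i)) :=
  [set F | ~ exists2 phi, slaloms b h phi & forall x, F x -> localized x phi].

Definition Lc_dominating (b : nat -> Type) (h : nat -> nat) :
    set (set (forall i, set (b i))) :=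
  [set D | D `<=` slaloms b h /\
           forall x : forall i, b i, exists2 phi, D phi & localized x phi].

Definition bLc (b : nat -> Type) (h : nat -> nat) : set (forall i, b i) :=
  min_size (Lc_unbounded b h).

Definition dLc (b : nat -> Type) (h : nat -> nat) :
    set (forall i, set (b i)) :=
  min_size (Lc_dominating b h).

Definition continuum : set (set nat) := setT.

(* Main.v *)
Require Import Defs.
From mathcomp Require Import all_boot.
From mathcomp Require Import mathcomp_extra boolp classical_sets functions.
From mathcomp Require Import cardinality filter.

Local Open Scope classical_set_scope.
Local Open Scope card_scope.

(** Let [A_N] be infinite with [N] least. A slalom has at most [N] values at
    each point of [A_N], so [N + 1] functions that are pairwise distinct on a
    tail of [A_N] cannot all be localized, while [N] functions always can since
    [h >= N] eventually.

    For the dominating number, take a family of reals-many functions on [A_N]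
    with values in [N + 1] such that any [N + 1] members take all values
    [0, ..., N] simultaneously at infinitely many points: enumerate along [A_N]
    all pairs [(n, t)] with [t] a list of binary words of length [n], and send
    [y] to the position in [t] of the restriction of [y] to [n]. Every slalom
    then localizes finitely many members, and the reals are not covered by
    fewer than continuum many countable sets. *)

(** * Cardinal comparisons and levels of functions on [nat] *)

Lemma card_le_of_inj {T U : Type} {A : set T} {B : set U} (f : T -> U) :
  (forall x, A x -> B (f x)) -> {in A &, injective f} -> A #<= B.
Proof.
move=> fAB finj; rewrite -(card_le_eql (inj_card_eq finj)).
by apply: subset_card_le => _ [x Ax <-]; exact: fAB.
Qed.

Lemma card_le_inj_ex {T U : Type} {A : set T} {B : set U} (u0 : U) :
  A #<= B ->
  exists2 f : T -> U, forall x, A x -> B (f x) & {in A &, injective f}.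
Proof.
move=> /card_leP[g].
pose f x := if pselect (A x) is left Ax then set_val (g (SigSub (mem_set Ax)))
            else u0.
exists f => [x Ax|x y].
  by rewrite /f; case: pselect => // Ax'; exact: set_valP.
rewrite !inE /f => Ax Ay; case: pselect => // {}Ax; case: pselect => // {}Ay.
move=> /val_inj /(@inj _ _ _ g) e.
by have /(congr1 set_val) := e (in_setT _) (in_setT _).
Qed.

Lemma card_nle_II {T : Type} {A : set T} {n : nat} :
  ~ (A #<= `I_n) -> `I_n.+1 #<= A.
Proof.
move=> nA; have [/finite_setP[m Am]|/infiniteP natA] := pselect (finite_set A).
  move: nA; rewrite (card_le_eql Am) (card_le_eqr Am) !card_le_II => /negP.
  by rewrite -ltnNge.
exact: card_le_trans (card_leT _) natA.
Qed.

Lemma finite_set_eventually_notin {A : set nat} :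
  finite_set A -> \forall i \near \oo, ~ A i.
Proof.
move=> /finite_seqP[s ->]; exists (\max_(i <- s) i).+1 => // i /= si is_.
by move: si; rewrite ltnNge (@leq_bigmax_seq _ s xpredT id i).
Qed.

Lemma eventually_ge_of_finite_levels {h : nat -> nat} {N : nat} :
  (forall m, m < N -> finite_set [set i | h i = m]) ->
  \forall i \near \oo, N <= h i.
Proof.
elim: N => [_|N IH fin]; first by exists 0.
have [k _ kP] := IH (fun m mN => fin m (ltnW mN)).
have [l _ lP] := finite_set_eventually_notin (fin N (ltnSn N)).
exists (maxn k l) => // i /=; rewrite geq_max => /andP[ki li].
by rewrite ltn_neqAle (kP i ki) andbT; apply/eqP => e; exact: (lP i li).
Qed.

(** * Separating families and countable covers of the reals *)

(** Indexing a copy of [nat] inside [A] by pairs [(q, c)] and letting [tau] read off [q] makes every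
    fibre infinite, hence unbounded. *)
Lemma infinite_set_recurrent {A : set nat} : infinite_set A ->
  exists tau : nat -> nat,
    forall q m, exists i, [/\ A i, m <= i & tau i = q].
Proof.
move=> /infiniteP /(card_le_inj_ex 0)[u uA uinj].
have uI : injective u by move=> x y; apply: uinj; rewrite in_setT.
have /choice[tau tauP] : forall i, exists q, forall p c : nat,
    u (pickle (p, c)) = i -> p = q.
  move=> i; have [[p [c e]]|ne] :=
    pselect (exists p c : nat, u (pickle (p, c)) = i).
    exists p => p' c' e'.
    by have /uI /(pcan_inj pickleK)[] : u (pickle (p, c)) = u (pickle (p', c'))
      by rewrite e e'.
  by exists 0 => p c e; case: ne; exists p, c.
exists tau => q m; apply: contrapT => H.
apply: infinite_nat; apply: (@card_le_finite _ _ _ `I_m); last exact: finite_II.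
apply: (card_le_of_inj (fun c => u (pickle (q, c)))) => [c _|c c' _ _].
  rewrite /= ltnNge; apply/negP => mc; apply: H.
  exists (u (pickle (q, c))); split => //; first exact: uA.
  by apply/esym/(tauP _ _ c).
by move=> /uI /(pcan_inj pickleK)[].
Qed.

(** Any two of the first [N + 1] functions differ at some point, and finitely many such points lie
    below a common [n]. *)
Lemma separating_restriction {g : nat -> nat -> bool} (N : nat) :
  injective g -> exists n, uniq (mkseq (fun j => mkseq (g j) n) N.+1).
Proof.
move=> ginj.
have /choice[d dP] : forall p : nat * nat, exists a,
    p.1 <> p.2 -> g p.1 a <> g p.2 a.
  move=> [j k] /=; apply: contrapT => H.
  have jk : j <> k by move=> jk; apply: H; exists 0 => /(_ jk).
  apply: jk; apply: ginj; apply/funext => a.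
  by apply: contrapT => ga; apply: H; exists a.
exists (\max_(j < N.+1) \max_(k < N.+1) d (val j, val k)).+1.
set n := _.+1.
rewrite map_inj_in_uniq ?iota_uniq// => j k.
rewrite !mem_iota !add0n => /andP[_ jN] /andP[_ kN] e.
apply: contrapT => /(dP (j, k)) /=; apply.
have dn : d (j, k) < n.
  rewrite ltnS (leq_trans _ (leq_bigmax (Ordinal jN)))//.
  exact: (@leq_bigmax _ (fun k : 'I_N.+1 => d (j, val k)) (Ordinal kN)).
by rewrite -(nth_mkseq false (g j) dn) e nth_mkseq.
Qed.

Lemma separating_family (N : nat) {A : set nat} : infinite_set A ->
  exists2 f : (nat -> bool) -> nat -> nat, (forall y i, f y i <= N) &
    forall g : nat -> nat -> bool, injective g ->
    forall m, exists i, [/\ A i, m <= i & forall j, j <= N -> f (g j) i = j].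
Proof.
move=> /infinite_set_recurrent[tau tauP].
pose c i : nat * seq (seq bool) := odflt (0, [::]) (unpickle (tau i)).
(* [index] returns the length of the list when the word is missing; [minn] caps the value at [N]. *)
exists (fun y i => minn N (index (mkseq y (c i).1) (c i).2)).
  by move=> y i; exact: geq_minl.
move=> g ginj m; have [n un] := separating_restriction N ginj.
set t := mkseq _ _ in un.
have [i [Ai mi ti]] := tauP (pickle (n, t)) m; exists i; split => // j jN.
rewrite /c ti pickleK [odflt _ _]/= [_.1]/= [_.2]/=.
have -> : mkseq (g j) n = nth [::] t j by rewrite nth_mkseq.
by rewrite index_uniq ?size_mkseq//; exact/minn_idPr.
Qed.

(* Diagonal argument: split a real into countably many reals. If for every [k]
   some real [z_k] is missed by the [k]-th parts of the [k]-th members of the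
   countable sets, the real with parts [(z_k)_k] is not covered. *)
Lemma continuum_le_countable_cover {T : Type} {D : set T}
    (R : T -> set (nat -> bool)) :
  (forall t, D t -> countable (R t)) ->
  (forall y, exists2 t, D t & R t y) -> continuum #<= D.
Proof.
move=> Rcount Rcov.
have /choice[e eP] : forall t, exists e : nat -> nat -> bool,
    D t -> forall y, R t y -> exists k, e k = y.
  move=> t; have [Dt|nDt] := pselect (D t); last by exists (fun _ _ => false).
  have /pfcard_geP[R0|[e]] := Rcount _ Dt.
    by exists (fun _ _ => false) => _ y; rewrite R0.
  by exists e => _ y /(@surj _ _ _ _ e)[k _ <-]; exists k.
apply: contrapT => nD.
have /choice[z zP] : forall k, exists z : nat -> bool,
    forall t, D t -> (fun l => e t k (pickle (k, l))) <> z.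
  (* If the [k]-th parts of the [k]-th members exhausted the reals, they would map [D] onto all the
     subsets of [nat]. *)
  move=> k; apply: contrapT => H; apply: nD.
  apply/pcard_surjP; exists (fun t => [set l | e t k (pickle (k, l))]) => S _.
  apply: contrapT => nS; apply: H; exists (fun l => `[< S l >]) => t Dt et.
  apply: nS; exists t => //; apply/seteqP; split => l /=.
    by move: (congr1 (@^~ l) et) => /= ->; move/asboolP.
  by move: (congr1 (@^~ l) et) => /= ->; move/asboolP.
pose y a := if unpickle a is Some (k, l) then z k l else false.
have [t Dt Rty] := Rcov y; have [k ek] := eP _ Dt _ Rty.
by apply: (zP k t Dt); apply/funext => l; rewrite ek /y pickleK.
Qed.

(** * Unbounded and dominating families: lower bounds *)

Lemma slalom_misses_point {b : nat -> Type} {h : nat -> nat}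
    {phi : forall i, set (b i)} {i : nat} (e : nat -> b i) :
  slaloms b h phi -> {in `I_(h i).+1 &, injective e} ->
  ~ (forall j, j <= h i -> phi i (e j)).
Proof.
move=> /(_ i) phi_h einj phi_e.
suff : `I_(h i).+1 #<= `I_(h i) by rewrite card_le_II ltnn.
by apply: card_le_trans phi_h; exact: (card_le_of_inj e).
Qed.

(** Transfers functions with values in [nat] to the product: at almost all [i], composing with [e i]
    keeps the values [0, ..., h i] apart. *)
Lemma distinct_points {b : nat -> Type} {h : nat -> nat} :
  (forall i, [set: b i] !=set0) ->
  (\forall i \near \oo, card_lt `I_(h i) [set: b i]) ->
  exists (e : forall i, nat -> b i),
    \forall i \near \oo, {in `I_(h i).+1 &, injective (e i)}.
Proof.
move=> b0 [m _ mP].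
have H i : exists e : nat -> b i,
    m <= i -> {in `I_(h i).+1 &, injective e}.
  have [x _] := b0 i; have [mi|mi] := pselect (m <= i); last by exists (fun=> x).
  have [_ /card_nle_II /(card_le_inj_ex x)[e _ einj]] := mP i mi.
  by exists e.
by exists (fun i => sval (cid (H i))); exists m => // i; exact: svalP (cid (H i)).
Qed.

Lemma le_Lc_unbounded {b : nat -> Type} {h : nat -> nat} {N : nat}
    {F : set (forall i, b i)} :
  (\forall i \near \oo, N <= h i) -> Lc_unbounded b h F -> `I_N.+1 #<= F.
Proof.
move=> [m _ mP] Fub; apply: card_nle_II => FN; apply: Fub.
(* The slalom collects all the values of [F], at most [N] at each point; it is empty below [m],
   where [h i] may be less than [N]. *)
exists (fun i => [set u | m <= i /\ exists2 x, F x & x i = u]) => [i|x Fx].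
  have [mi|mi] := pselect (m <= i); last first.
    by rewrite (_ : [set u | _] = set0) ?card_ge0// -subset0 => u [].
  have -> : [set u | m <= i /\ exists2 x, F x & x i = u] =
      (fun x : forall i, b i => x i) @` F.
    by apply/seteqP; split => [u []//|u Fu]; split.
  apply: card_le_trans (card_image_le _ _) _; apply: card_le_trans FN _.
  by rewrite card_le_II; exact: mP.
by exists m => // i mi; split => //; exists x.
Qed.

Lemma Lc_unbounded_range {b : nat -> Type} {h : nat -> nat} {N : nat}
    (e : forall i, nat -> b i) :
  infinite_set [set i | h i = N] ->
  (\forall i \near \oo, {in `I_(h i).+1 &, injective (e i)}) ->
  Lc_unbounded b h ((fun j i => e i j) @` `I_N.+1).
Proof.
move=> Ninf [m _ mP] [phi phiS philoc].
have [tau tauP] := infinite_set_recurrent Ninf.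
have /choice[k kP] : forall j, exists k, j <= N ->
    forall i, k <= i -> phi i (e i j).
  move=> j; have [jN|jN] := pselect (j <= N); last by exists 0.
  by have [|k _ kP] := philoc (fun i => e i j); [exists j | exists k].
(* The value 0 is arbitrary: [tauP] serves to find a point of the level set beyond all the
   thresholds. *)
have [i [/= hi mi _]] := tauP 0 (maxn m (\max_(j < N.+1) k j)).
move: mi; rewrite geq_max => /andP[mi ki].
apply: (slalom_misses_point (e i) phiS (mP i mi)) => j; rewrite hi => jN.
apply: kP => //; apply: leq_trans ki.
exact: (@leq_bigmax _ (fun j : 'I_N.+1 => k j) (Ordinal (jN : j < N.+1))).
Qed.

Lemma continuum_le_Lc_dominating {b : nat -> Type} {h : nat -> nat} {N : nat}
    {D : set (forall i, set (b i))} (e : forall i, nat -> b i) :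
  infinite_set [set i | h i = N] ->
  (\forall i \near \oo, {in `I_(h i).+1 &, injective (e i)}) ->
  Lc_dominating b h D -> continuum #<= D.
Proof.
move=> Ninf [m _ mP] [DS Ddom].
have [f fN fsep] := separating_family N Ninf.
pose R phi := [set y | @localized b (fun i => e i (f y i)) phi].
apply: (continuum_le_countable_cover R) => [phi Dphi|y]; last exact: Ddom.
(* An infinite [R phi] contains an injective sequence [g]. Beyond the thresholds of its first
   [N + 1] members, [fsep] gives a point of the level set where they take all the values up to [N],
   which forces [N + 1] distinct points into [phi i]. *)
apply: finite_set_countable; apply: contrapT.
move=> /infiniteP /(card_le_inj_ex (fun=> false))[g gR ginj].
have /choice[k kP] : forall j, exists k,
    forall i, k <= i -> phi i (e i (f (g j) i)).
  by move=> j; have [k _ kP] := gR j Logic.I; exists k.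
have gI : injective g by move=> x y; apply: ginj; rewrite in_setT.
have [i [/= hi mi fi]] := fsep g gI (maxn m (\max_(j < N.+1) k j)).
move: mi; rewrite geq_max => /andP[mi ki].
apply: (slalom_misses_point (e i) (DS _ Dphi) (mP i mi)) => j; rewrite hi => jN.
rewrite -(fi j jN); apply: kP; apply: leq_trans ki.
exact: (@leq_bigmax _ (fun j : 'I_N.+1 => k j) (Ordinal (jN : j < N.+1))).
Qed.

(** * Upper bound for the dominating number *)

(** These slaloms amount to the members of the product restricted to [i >= m]. They are empty below
    [m], where [h i] may be 0 and [b i] may be larger than the continuum. *)
Definition tail_singletons (b : nat -> Type) (m : nat) :
    set (forall i, set (b i)) :=
  [set phi | forall i, if m <= i then exists x, phi i = [set x]
                       else phi i = set0].

Lemma Lc_dominating_tail_singletons {b : nat -> Type} {h : nat -> nat}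
    {m : nat} :
  (forall i, m <= i -> 1 <= h i) -> Lc_dominating b h (tail_singletons b m).
Proof.
move=> h1; split => [phi phiP i|x].
  move: (phiP i); case: ifPn => [mi [x ->]|_ ->]; last exact: card_ge0.
  by rewrite (card_le_eql card_set1) card_le_II h1.
exists (fun i => if m <= i then [set x i] else set0) => [i|].
  by case: (m <= i) => //; exists (x i).
by exists m => // i /= ->.
Qed.

(** A slalom is coded by the pairs [(i, l)] with [l] in the subset of [nat] that [c i] attaches to
    the point of [phi i]. Below [m] the slaloms are empty, so an arbitrary [c i] does no harm
    there. *)
Lemma tail_singletons_le_continuum {b : nat -> Type} {m : nat} :
  (forall i, m <= i -> [set: b i] #<= continuum) ->
  tail_singletons b m #<= continuum.
Proof.
move=> bc.
have H i : exists c : b i -> set nat, m <= i -> injective c.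
  have [mi|mi] := pselect (m <= i); last by exists (fun=> set0).
  have [c _ cinj] := card_le_inj_ex set0 (bc i mi).
  by exists c => _ x y; apply: cinj; rewrite in_setT.
pose c i := sval (cid (H i)).
have cI i : m <= i -> injective (c i) := svalP (cid (H i)).
apply: (card_le_of_inj (fun phi : forall i, set (b i) =>
  [set a | exists i l, a = pickle (i, l) /\ exists2 x, phi i x & c i x l])) => //.
move=> phi psi; rewrite !inE => phiP psiP E; apply/functional_extensionality_dep.
move=> i; move: (phiP i) (psiP i); case: ifPn => [mi [x phix] [y psiy]|_ -> ->//].
rewrite phix psiy; congr [set _]; apply: (cI i mi); apply/seteqP; split => l cl.
  have : [set a | exists i l, a = pickle (i, l) /\
      exists2 x, phi i x & c i x l] (pickle (i, l)).
    by exists i, l; split => //; exists x; rewrite ?phix.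
  rewrite E => -[i' [l' [/(pcan_inj pickleK)[<- <-] [y' ]]]].
  by rewrite psiy => ->.
have : [set a | exists i l, a = pickle (i, l) /\
    exists2 x, psi i x & c i x l] (pickle (i, l)).
  by exists i, l; split => //; exists y; rewrite ?psiy.
rewrite -E => -[i' [l' [/(pcan_inj pickleK)[<- <-] [x' ]]]].
by rewrite phix => ->.
Qed.

(** If all levels were finite, [h] would eventually be at least any given [n], hence tend to
    infinity. *)
Lemma least_infinite_level {h : nat -> nat} :
  ~ (h @ \oo --> \oo) ->
  exists2 N, infinite_set [set i | h i = N] &
    forall m, infinite_set [set i | h i = m] -> N <= m.
Proof.
move=> hncvg.
have exN : exists N, `[< infinite_set [set i | h i = N] >].
  apply: contrapT => H; apply: hncvg => A [n _ nA].
  have [|k _ kP] := @eventually_ge_of_finite_levels h n.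
    move=> m _; apply: contrapT => Hm; apply: H.
    by exists m; apply/asboolP.
  by exists k => // i ki; apply: nA; exact: kP.
case: (ex_minnP exN) => N /asboolP Ninf Nmin.
by exists N => // m minf; apply: Nmin; apply/asboolP.
Qed.

Theorem theorem3p1 (b : nat -> Type) (h : nat -> nat)
    (b_neq0 : forall i, [set: b i] !=set0)
    (h_ge1 : \forall i \near \oo, 1 <= h i)
    (h_lt_b : \forall i \near \oo, card_lt `I_(h i) [set: b i])
    (h_noncvg : ~ (h @ \oo --> \oo)) :
  [/\ continuum #<= dLc b h,
      exists N : nat,
        [/\ infinite_set [set i | h i = N],
            forall m : nat, infinite_set [set i | h i = m] -> N <= m
          & bLc b h #= `I_N.+1]
    & (\forall i \near \oo, [set: b i] #<= continuum) ->
        dLc b h #= continuum].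
Proof.
have [N Ninf Nmin] := least_infinite_level h_noncvg.
have [e einj] := distinct_points b_neq0 h_lt_b.
have [m _ h1] := h_ge1.
have [dP dmin] : has_min_size (Lc_dominating b h) (dLc b h).
  apply: min_sizeP; exists (tail_singletons b m).
  exact: Lc_dominating_tail_singletons.
have cd : continuum #<= dLc b h by exact: continuum_le_Lc_dominating Ninf einj dP.
split => //.
  exists N; split => //.
  have Fub := Lc_unbounded_range e Ninf einj.
  have [bP bmin] : has_min_size (Lc_unbounded b h) (bLc b h).
    by apply: min_sizeP; eexists; exact: Fub.
  rewrite card_eq_le; apply/andP; split.
    by apply: card_le_trans (bmin _ Fub) _; exact: card_image_le.
  (* By minimality of [N], all lower levels are finite. *)
  apply: le_Lc_unbounded bP; apply: eventually_ge_of_finite_levels => k kN.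
  by apply: contrapT => /Nmin; rewrite leqNgt kN.
move=> [k _ bc]; rewrite card_eq_le cd andbT.
(* Beyond [maxn m k], both [1 <= h i] and the bound on [b i] hold. *)
apply: card_le_trans (dmin (tail_singletons b (maxn m k)) _) _.
  apply: Lc_dominating_tail_singletons => i.
  by rewrite geq_max => /andP[mi _]; exact: h1.
apply: tail_singletons_le_continuum => i; rewrite geq_max => /andP[_ ki].
exact: bc.
Qed.
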